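(* Let $S$ be a $\Gamma$-semiring with zero and with unities. Then $FLI(S)$ (respectively $FRI(S)$, $FI(S)$), partially ordered by $\mu_1\le\mu_2$ if and only if $\mu_1(x)\le\mu_2(x)$ for all $x\in S$, is a complete lattice.
   Context: Let $S$ and $\Gamma$ be additive commutative semigroups. $S$ is a $\Gamma$-semiring if there is a map $S\times\Gamma\times S\to S$, $(a,\alpha,b)\mapsto a\alpha b$, with $(a+b)\alpha c=a\alpha c+b\alpha c$, $a\alpha(b+c)=a\alpha b+a\alpha c$, $a(\alpha+\beta)b=a\alpha b+a\beta b$, $a\alpha(b\beta c)=(a\alpha b)\beta c$ for all $a,b,c\in S$, $\alpha,\beta\in\Gamma$. It is with zero if $(S,+)$ and $(\Gamma,+)$ are monoids with identities $0_S,0_\Gamma$ (both written $0$) and $0_S\alpha x=0_S=x\alpha 0_S$, $x0_\Gamma y=0_S=y0_\Gamma x$ for all $x,y\in S$, $\alpha\in\Gamma$. It is with unities if there are finite families $e_i\in S,\delta_i\in\Gamma$ with $\sum_i e_i\delta_i x=x$ for all $x\in S$ (left unity) and finite families $\nu_j\in\Gamma,f_j\in S$ with $\sum_j x\nu_j f_j=x$ for all $x\in S$ (right unity). A fuzzy subset of $S$ is a map $\mu:S\to[0,1]$; it is non empty if $\mu(x)\neq0$ for some $x$. A fuzzy left ideal (resp. fuzzy right ideal) of $S$ is a non empty fuzzy subset $\mu$ with $\mu(x+y)\ge\min[\mu(x),\mu(y)]$ and $\mu(x\gamma y)\ge\mu(y)$ (resp. $\mu(x\gamma y)\ge\mu(x)$)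 for all $x,y\in S,\gamma\in\Gamma$. A fuzzy ideal is both a fuzzy left and a fuzzy right ideal. Convention: all fuzzy left ideals, fuzzy right ideals and fuzzy ideals $\mu$ are assumed to satisfy $\mu(0)=1$. $FLI(S)$, $FRI(S)$, $FI(S)$ denote the sets of all fuzzy left ideals, fuzzy right ideals, fuzzy ideals of $S$ (with this convention). *)

(* Defs.v *)
From HB Require Import structures.
From mathcomp Require Import all_boot all_order all_algebra.
From mathcomp Require Import interval_inference.
From mathcomp Require Import boolp classical_sets reals.

Set Implicit Arguments.
Unset Strict Implicit.
Unset Printing Implicit Defensive.

Import Order.TTheory GRing.Theory Num.Theory.

Local Open Scope classical_set_scope.
Local Open Scope ring_scope.

(* In MathComp, the addition of an addSemigroupType is commutative. *)
Definition gamma_semiring (S G : addSemigroupType) (op : S -> G -> S -> S) :=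
  [/\ forall a b g c, op (a + b) g c = op a g c + op b g c,
      forall a g b c, op a g (b + c) = op a g b + op a g c,
      forall a g h b, op a (g + h) b = op a g b + op a h b &
      forall a g b h c, op a g (op b h c) = op (op a g b) h c].

Section GammaSemiring.
Variables (S G : nmodType) (op : S -> G -> S -> S).

(* That (S, +, 0) and (G, +, 0) are commutative monoids is part of nmodType. *)
Definition with_zero :=
  (forall g x, op 0 g x = 0 /\ op x g 0 = 0) /\
  (forall x y, op x 0 y = 0 /\ op y 0 x = 0).

Definition left_unity n (e : 'I_n -> S) (d : 'I_n -> G) :=
  forall x, \sum_(i < n) op (e i) (d i) x = x.

Definition right_unity n (nu : 'I_n -> G) (f : 'I_n -> S) :=
  forall x, \sum_(j < n) op x (nu j) (f j) = x.

Definition with_unities :=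
  (exists n (e : 'I_n -> S) (d : 'I_n -> G), left_unity e d) /\
  (exists n (nu : 'I_n -> G) (f : 'I_n -> S), right_unity nu f).

Variable R : realType.

(* {i01 R} is the type of the elements of the real interval [0, 1]. *)
Local Notation fuzzy_subset := (S -> {i01 R}).

Implicit Type mu : fuzzy_subset.

Definition fuzzy_nonempty mu := exists x, (mu x)%:num != 0.

Definition fuzzy_left_ideal mu :=
  [/\ fuzzy_nonempty mu,
      forall x y, Order.min (mu x) (mu y) <= mu (x + y) &
      forall x g y, mu y <= mu (op x g y)].

Definition fuzzy_right_ideal mu :=
  [/\ fuzzy_nonempty mu,
      forall x y, Order.min (mu x) (mu y) <= mu (x + y) &
      forall x g y, mu x <= mu (op x g y)].

Definition fuzzy_ideal mu := fuzzy_left_ideal mu /\ fuzzy_right_ideal mu.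

Definition FLI : set fuzzy_subset :=
  [set mu | fuzzy_left_ideal mu /\ (mu 0)%:num = 1].
Definition FRI : set fuzzy_subset :=
  [set mu | fuzzy_right_ideal mu /\ (mu 0)%:num = 1].
Definition FI : set fuzzy_subset :=
  [set mu | fuzzy_ideal mu /\ (mu 0)%:num = 1].

End GammaSemiring.

Arguments FLI {S G} op R _.
Arguments FRI {S G} op R _.
Arguments FI {S G} op R _.

(* A subset of a poset carries the induced order. *)
HB.instance Definition _ d (T : porderType d) (P : pred T) :=
  [SubChoice_isSubPOrder of {x | P x} by <: with d].

(* boolp orders functions pointwise, hence so are sets of functions. *)
Lemma fun_leP d (aT : Type) (T : porderType d) (E : set (aT -> T))
    (f g : set_type E) :
  reflect (forall x, (val f x <= val g x)%O) (f <= g)%O.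
Proof. exact: asboolP. Qed.

(* E with its induced order is a complete lattice; A may be empty, and the
   suprema and infima are taken in E. *)
Definition complete_lattice d (T : porderType d) (E : set T) :=
  forall A : set (set_type E), supremums A !=set0 /\ infimums A !=set0.

(* Main.v *)
(* Every intersection (pointwise infimum) of fuzzy ideals is a fuzzy ideal, the
   empty one being the constant function 1. So infima exist, and the supremum of
   a family is the infimum of its upper bounds. *)
Require Import Defs.
From mathcomp Require Import all_boot all_order all_algebra.
From mathcomp Require Import interval_inference.
From mathcomp Require Import boolp classical_sets reals.

Set Implicit Arguments.
Unset Strict Implicit.
Unset Printing Implicit Defensive.

Import Order.TTheory GRing.Theory Num.Theory.

Local Open Scope classical_set_scope.
Local Open Scope ring_scope.

(** The order on [E] is induced, so an infimum computed in [T] that happens to lie in [E] is also an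
    infimum in [E]. *)
Lemma complete_lattice_infimums d (T : porderType d) (E : set T) :
  (forall A, A `<=` E -> E `&` infimums A !=set0) -> complete_lattice E.
Proof.
move=> Einf.
have inf (A : set (set_type E)) : infimums A !=set0.
  have [|m [Em [m_lb m_glb]]] := Einf [set val a | a in A].
    by move=> _ [a _ <-]; exact: set_mem (valP a).
  exists (exist _ m (mem_set Em)); split=> [a Aa|b b_lb].
    by apply: m_lb; exists a.
  by apply: m_glb => _ [a Aa <-]; exact: b_lb.
(* Every element of [A] is a lower bound of [ubound A], hence lies below [m]; that [m] is the least
   upper bound is [m_lb]. *)
move=> A; split=> //; have [m [m_lb m_glb]] := inf (ubound A).
by exists m; split=> // a Aa; apply: m_glb => b; apply.
Qed.

Section PointwiseInfimum.
Variable R : realType.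

(* Adding 1 gives the empty set the infimum 1; [inf] would give it 0. *)
Lemma i01_infimums (A : set {i01 R}) : infimums A !=set0.
Proof.
pose B : set R := [set a%:num | a in A] `|` [set 1].
have B1 : B 1 by right.
have B_lb : lbound B 0 by move=> _ [[a _ <-]|->].
have B0 : has_lbound B by exists 0.
have inf_ge0 : 0 <= inf B by apply: lb_le_inf => //; exists 1.
have inf_le1 : inf B <= 1 by exact: ge_inf.
exists (Itv01 inf_ge0 inf_le1); split=> [a Aa|b b_lb]; rewrite -num_le /=.
  by apply: ge_inf => //; left; exists a.
apply: lb_le_inf; first by exists 1.
by move=> _ [[a Aa <-]|->]; [rewrite num_le; exact: b_lb|].
Qed.

(** Infima are unique by antisymmetry, so the choice made by [cid] is harmless. *)
Definition pointwise_inf (S : Type) (F : set (S -> {i01 R})) : S -> {i01 R} :=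
  fun x => sval (cid (i01_infimums [set mu x | mu in F])).

(** This universal property replaces the definition of [pointwise_inf] in all that follows. *)
Lemma le_pointwise_inf (S : Type) (F : set (S -> {i01 R})) x b :
  b <= pointwise_inf F x <-> (forall mu, F mu -> b <= mu x).
Proof.
rewrite /pointwise_inf; case: cid => m /= [m_lb m_glb]; split=> [bm mu Fmu|b_lb].
  by apply: le_trans bm _; apply: m_lb; exists mu.
by apply: m_glb => _ [mu Fmu <-]; exact: b_lb.
Qed.

Lemma pointwise_inf_le (S : Type) (F : set (S -> {i01 R})) mu x :
  F mu -> pointwise_inf F x <= mu x.
Proof. by move=> Fmu; exact: (le_pointwise_inf F x _).1. Qed.

Lemma infimums_pointwise_inf (S : Type) (F : set (S -> {i01 R})) :
  infimums F (pointwise_inf F).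
Proof.
split=> [mu Fmu|nu nu_lb]; apply/asboolP => x; first exact: pointwise_inf_le.
by apply/le_pointwise_inf => mu Fmu; have /asboolP := nu_lb _ Fmu; apply.
Qed.

Lemma pointwise_inf_eq1 (S : Type) (F : set (S -> {i01 R})) x :
  (forall mu, F mu -> (mu x)%:num = 1) -> (pointwise_inf F x)%:num = 1.
Proof.
move=> F1; apply/eqP; rewrite eq_le le1 /=.
(* The real number 1 is repackaged as an element of [{i01 R}], where [le_pointwise_inf] applies. *)
pose one : {i01 R} := Itv01 ler01 (lexx 1); rewrite -[leLHS]/one%:num num_le.
by apply/le_pointwise_inf => mu Fmu; rewrite -num_le /= F1.
Qed.

(** Serves the absorption conditions, with a product in the place of [y]. *)
Lemma pointwise_inf_le2 (S : Type) (F : set (S -> {i01 R})) x y :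
  (forall mu, F mu -> mu x <= mu y) -> pointwise_inf F x <= pointwise_inf F y.
Proof.
move=> Fxy; apply/le_pointwise_inf => mu Fmu.
exact: le_trans (pointwise_inf_le x Fmu) (Fxy _ Fmu).
Qed.

Lemma pointwise_inf_min (S : Type) (F : set (S -> {i01 R})) x y z :
  (forall mu, F mu -> Order.min (mu x) (mu y) <= mu z) ->
  Order.min (pointwise_inf F x) (pointwise_inf F y) <= pointwise_inf F z.
Proof.
move=> Fxyz; apply/le_pointwise_inf => mu Fmu; apply: le_trans (Fxyz _ Fmu).
by rewrite le_min !ge_min !(pointwise_inf_le _ Fmu) orbT.
Qed.

Variables (S G : nmodType) (op : S -> G -> S -> S).
Implicit Type F : set (S -> {i01 R}).

(** An infimum of non empty fuzzy subsets may vanish everywhere; the convention at [0] rules this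
    out. *)
Lemma fuzzy_nonempty_at0 (mu : S -> {i01 R}) :
  (mu 0)%:num = 1 -> fuzzy_nonempty mu.
Proof. by move=> mu1; exists 0; rewrite mu1 oner_neq0. Qed.

Lemma FLI_pointwise_inf F : F `<=` FLI op R -> FLI op R (pointwise_inf F).
Proof.
move=> FE; have inf1 : (pointwise_inf F 0)%:num = 1.
  by apply: pointwise_inf_eq1 => mu /FE[].
split=> //; split; first exact: fuzzy_nonempty_at0.
  by move=> x y; apply: pointwise_inf_min => mu /FE[[_ + _] _]; apply.
by move=> x g y; apply: pointwise_inf_le2 => mu /FE[[_ _ +] _]; apply.
Qed.

Lemma FRI_pointwise_inf F : F `<=` FRI op R -> FRI op R (pointwise_inf F).
Proof.
move=> FE; have inf1 : (pointwise_inf F 0)%:num = 1.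
  by apply: pointwise_inf_eq1 => mu /FE[].
split=> //; split; first exact: fuzzy_nonempty_at0.
  by move=> x y; apply: pointwise_inf_min => mu /FE[[_ + _] _]; apply.
by move=> x g y; apply: pointwise_inf_le2 => mu /FE[[_ _ +] _]; apply.
Qed.

(** Reduces the two-sided case to the two one-sided ones. *)
Lemma FI_setI : FI op R = FLI op R `&` FRI op R.
Proof.
apply/seteqP; split=> mu; first by case=> [[? ?] ?].
by case=> [[? ?] [? _]].
Qed.

Lemma FI_pointwise_inf F : F `<=` FI op R -> FI op R (pointwise_inf F).
Proof.
rewrite FI_setI subsetI => -[FL FR].
by split; [exact: FLI_pointwise_inf|exact: FRI_pointwise_inf].
Qed.

End PointwiseInfimum.

Theorem theorem3p16 (R : realType) (S G : nmodType) (op : S -> G -> S -> S)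
    (op_semiring : gamma_semiring op)
    (op_zero : with_zero op)
    (op_unities : with_unities op) :
  complete_lattice (FLI op R) /\
  complete_lattice (FRI op R) /\
  complete_lattice (FI op R).
Proof.
(* In all three cases the infimum is the one of the whole function space; only its membership
   differs. *)
split; [|split]; apply: complete_lattice_infimums => F FE;
  exists (pointwise_inf F); split; try exact: infimums_pointwise_inf.
- exact: FLI_pointwise_inf.
- exact: FRI_pointwise_inf.
- exact: FI_pointwise_inf.
Qed.
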